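(* Let $d\ge 1$, let $q$ be the order and $\epsilon$ the type of a finite classical polar space of rank $d$, and let $P_{r,s}$ ($0\le r,s\le d$) be the eigenvalues of the dual polar association scheme given below. For $0\le a<d$ and $0\le r\le d$ put $\lambda_r^a=\sum_{s=0}^a P_{r,d-s}$. Then for $a<d$, $$\lambda_0^a=\sum_{s=0}^a\genfrac{[}{]}{0pt}{}{d}{s}_q q^{\binom{d-s}{2}+(d-s)\epsilon},$$ and for $a<d$ and $r>0$, $$\lambda_r^a=(-1)^{r+a}\sum_{s=\max(a-r+1,0)}^{\min(a,d-r)}(-1)^sA(r,s,a),\quad A(r,s,a):=\genfrac{[}{]}{0pt}{}{d-r}{s}_q q^{\binom{d-r-s}{2}+(d-r-s)\epsilon}\genfrac{[}{]}{0pt}{}{r-1}{a-s}_q q^{\binom{r-a+s}{2}}.$$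
   Context: For a polar space of rank $d$ and type $\epsilon$ ($\epsilon=0,\frac12,1,1,\frac32,2$ for $Q^+(2d-1,q)$, $H(2d-1,q)$, $Q(2d,q)$, $W(2d-1,q)$, $H(2d,q)$, $Q^-(2d+1,q)$), let $A_i$ be the adjacency matrix on generators with $(A_i)_{xy}=1$ iff $d-\dim(x\cap y)=i$. These matrices have common eigenspaces $V_0,\dots,V_d$, and $A_s$ acts on $V_r$ as the scalar $$P_{r,s}=\sum_{t=\max(r-s,0)}^{\min(d-s,r)}(-1)^{r-t}\genfrac{[}{]}{0pt}{}{d-r}{d-s-t}_q\genfrac{[}{]}{0pt}{}{r}{t}_q q^{\binom{r-t}{2}+\binom{s-r+t}{2}+(s-r+t)\epsilon}.$$ Thus $\lambda_r^a$ is the eigenvalue of $\sum_{s=0}^aA_{d-s}$ on $V_r$. Gaussian coefficient $\genfrac{[}{]}{0pt}{}{n}{k}_q=\prod_{i=1}^k\frac{q^{n-i+1}-1}{q^i-1}$ for $0\le k\le n$, $0$ otherwise; $\binom m2=m(m-1)/2$. *)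

(* Defs.v *)
From mathcomp Require Export all_boot all_order all_algebra.
From mathcomp Require Export reals exp.

Set Implicit Arguments.
Unset Strict Implicit.
Unset Printing Implicit Defensive.

Import Order.TTheory GRing.Theory Num.Theory.
Local Open Scope ring_scope.

(* The six families of finite classical polar spaces of rank d:               *)
(* Q+(2d-1,q), H(2d-1,q), Q(2d,q), W(2d-1,q), H(2d,q), Q-(2d+1,q).            *)
Variant polar_family :=
  | Qplus | Hodd | Qpar | Wsymp | Heven | Qminus.

Definition polar_type (R : realType) (X : polar_family) : R :=
  match X with
  | Qplus => 0
  | Hodd => 1 / 2
  | Qpar => 1
  | Wsymp => 1
  | Heven => 3 / 2
  | Qminus => 2
  end.
Arguments polar_type : clear implicits.

Definition prime_power (q : nat) : Prop :=
  exists p k : nat, [/\ prime p, (0 < k)%N & q = (p ^ k)%N].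

(* A Hermitian form lives over a field with an involution, so q is then a     *)
(* square; the other families exist over every finite field, in every rank    *)
(* d >= 1.                                                                    *)
Definition polar_order (X : polar_family) (q : nat) : Prop :=
  match X with
  | Hodd | Heven => exists2 q0 : nat, prime_power q0 & q = (q0 ^ 2)%N
  | _ => prime_power q
  end.

Definition gauss_binom (R : realType) (q n k : nat) : R :=
  if (k <= n)%N then
    \prod_(1 <= i < k.+1) ((q%:R ^+ (n - i + 1) - 1) / (q%:R ^+ i - 1))
  else 0.
Arguments gauss_binom : clear implicits.

(* P_{r,s} for r, s <= d. Over the range of t all the natural number          *)
(* subtractions are exact; the lower bound r - s is max(r - s, 0). The power  *)
(* of q is a real power, since eps may be a half-integer.                     *)
Definition dual_polar_P (R : realType) (d q : nat) (eps : R) (r s : nat) : R :=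
  \sum_(r - s <= t < (minn (d - s) r).+1)
    (-1) ^+ (r - t) * gauss_binom R q (d - r) (d - s - t) * gauss_binom R q r t
    * q%:R `^ ('C(r - t, 2)%:R + 'C(s + t - r, 2)%:R + (s + t - r)%:R * eps).

Definition lambda (R : realType) (d q : nat) (eps : R) (r a : nat) : R :=
  \sum_(0 <= s < a.+1) dual_polar_P d q eps r (d - s).

(* Used for a - r < s <= min(a, d - r), where all subtractions are exact.     *)
Definition Acoef (R : realType) (d q : nat) (eps : R) (r s a : nat) : R :=
  gauss_binom R q (d - r) s
  * q%:R `^ ('C(d - r - s, 2)%:R + (d - r - s)%:R * eps)
  * gauss_binom R q (r - 1) (a - s) * q%:R `^ 'C(r + s - a, 2)%:R.

(* Main.v *)
Require Import Defs.
From mathcomp Require Import ring zify.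
Import Order.TTheory GRing.Theory Num.Theory.
Local Open Scope ring_scope.

(** The exponent of q in the t-th term of P_{r,d-s} separates into a part
    depending on t and a part depending on u = s - t.  Summing over s <= a thus
    leaves, for each u, the partial alternating sum over t <= a - u of
    (-1)^(r-t) [r, t] q^C(r-t, 2), which telescopes by the q-Pascal rule to
    (-1)^(r-a+u) [r-1, a-u] q^C(r-a+u, 2). *)

Lemma prime_power_gt1 (q : nat) : prime_power q -> (1 < q)%N.
Proof.
move=> [p [k [pp k0 ->]]].
by rewrite -[1%N](expn0 p) ltn_exp2l ?prime_gt1.
Qed.

Lemma polar_order_gt1 (X : polar_family) (q : nat) :
  polar_order X q -> (1 < q)%N.
Proof.
case: X => /=; try exact: prime_power_gt1.
  by move=> [q0 /prime_power_gt1 h ->]; rewrite (ltn_sqr 1 q0).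
by move=> [q0 /prime_power_gt1 h ->]; rewrite (ltn_sqr 1 q0).
Qed.

Lemma gauss_binom0 (R : realType) (q n : nat) : gauss_binom R q n 0 = 1.
Proof. by rewrite /gauss_binom big_geq. Qed.

Lemma gauss_binom_small (R : realType) (q n k : nat) :
  (n < k)%N -> gauss_binom R q n k = 0.
Proof. by move=> h; rewrite /gauss_binom leqNgt h. Qed.

Lemma gauss_binomnS (R : realType) (q n k : nat) : (k <= n)%N ->
  gauss_binom R q n k.+1
  = gauss_binom R q n k * ((q%:R ^+ (n - k) - 1) / (q%:R ^+ k.+1 - 1)).
Proof.
move=> kn; rewrite /gauss_binom kn; case: ltnP => h.
  by rewrite big_nat_recr //=; congr (_ * ((_ ^+ _ - 1) / _)); lia.
(* At k = n the left side is 0 by convention and the right side vanishes through the factor q^0 -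
   1. *)
by rewrite (_ : n - k = 0)%N ?expr0 ?subrr ?mul0r ?mulr0 //; lia.
Qed.

Lemma expr_natr_neq1 (R : realType) (q k : nat) : (1 < q)%N ->
  q%:R ^+ k.+1 - 1 != 0 :> R.
Proof.
by move=> q1; rewrite subr_eq0 gt_eqF // exprn_egt1 // ltr1n.
Qed.

Lemma gauss_binomSS (R : realType) (q n k : nat) : (1 < q)%N -> (k <= n)%N ->
  gauss_binom R q n.+1 k.+1
  = gauss_binom R q n k * ((q%:R ^+ n.+1 - 1) / (q%:R ^+ k.+1 - 1)).
Proof.
move=> q1; elim: k => [|k IH] kn.
  by rewrite gauss_binomnS // !gauss_binom0 subn0.
rewrite gauss_binomnS; last exact: leqW.
rewrite IH ?(ltnW kn) // subSS gauss_binomnS ?(ltnW kn) //.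
have := expr_natr_neq1 R q k q1; have := expr_natr_neq1 R q k.+1 q1.
move: (_ ^+ k.+2) (_ ^+ k.+1) => x y hx hy.
by field; rewrite hx hy.
Qed.

(** For k <= n, all three coefficients are multiples of [n, k], and the claim reduces to q^(n+1) - 1
    = (q^(n-k) - 1) + q^(n-k) (q^(k+1) - 1). *)
Lemma gauss_binom_pascal (R : realType) (q n k : nat) : (1 < q)%N ->
  gauss_binom R q n.+1 k.+1
  = gauss_binom R q n k.+1 + q%:R ^+ (n - k) * gauss_binom R q n k.
Proof.
move=> q1; case: (leqP k n) => kn; last first.
  by rewrite !gauss_binom_small ?mulr0 ?addr0 //; lia.
rewrite gauss_binomSS // gauss_binomnS //.
rewrite (_ : q%:R ^+ n.+1 = q%:R ^+ (n - k) * q%:R ^+ k.+1); last first.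
  by rewrite -exprD; congr (_ ^+ _); lia.
have := expr_natr_neq1 R q k q1.
by move: (_ ^+ k.+1) (_ ^+ (n - k)) => x y hx; field.
Qed.

Lemma sum_gauss_binom_signed (R : realType) (q n m : nat) : (1 < q)%N ->
  \sum_(0 <= t < m.+1)
     (-1) ^+ (n.+1 - t) * gauss_binom R q n.+1 t * q%:R ^+ 'C(n.+1 - t, 2)
  = (-1) ^+ (n.+1 - m) * gauss_binom R q n m * q%:R ^+ 'C(n.+1 - m, 2).
Proof.
move=> q1; elim: m => [|m IH]; first by rewrite big_nat1 !gauss_binom0.
rewrite big_nat_recr //= IH gauss_binom_pascal //.
case: (leqP m n) => mn; last by rewrite !gauss_binom_small //; [ring | lia].
(* Since C(n+1-m, 2) = C(n-m, 2) + (n-m), the [n, m] part of the new term cancels the sum so far,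
   and only its [n, m+1] part survives. *)
rewrite subSS subSn // binS bin1 addnC !exprD exprS; ring.
Qed.

Lemma sum_antidiagonals (V : nmodType) (f : nat -> nat -> V) (a : nat) :
  \sum_(0 <= s < a.+1) \sum_(0 <= t < s.+1) f t (s - t)%N
  = \sum_(0 <= u < a.+1) \sum_(0 <= t < (a - u).+1) f t u.
Proof.
elim: a => [|a IH]; first by rewrite !big_nat1.
rewrite big_nat_recr //= IH [RHS]big_nat_recr //= subnn big_nat1.
(* Reversal indexes the new antidiagonal s = a+1 by u: its last term is the new row u = a+1, and the
   others extend the rows u <= a by one term each. *)
rewrite [X in _ + X = _]big_nat_rev [X in _ + X = _]big_nat_recr //= addrA.
rewrite (_ : _ - a.+2 = 0)%N ?subn0; last by lia.
congr (_ + _); rewrite -big_split; apply: eq_big_nat => u ua /=.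
rewrite (_ : a.+1 - u = (a - u).+1)%N; last by lia.
by rewrite [RHS]big_nat_recr //=; congr (_ + f _ _); lia.
Qed.

Lemma natr_powRD_nat (R : realType) (q m : nat) (x : R) : (1 < q)%N ->
  q%:R `^ (m%:R + x) = q%:R ^+ m * q%:R `^ x.
Proof.
move=> q1; rewrite powRD ?powR_mulrn ?ler0n //.
by apply/implyP => _; rewrite pnatr_eq0; lia.
Qed.

(** The range of t can be widened to 0 <= t <= s because the added terms are zero: [r, t] = 0 when t
    > r, and [d-r, s-t] = 0 when t < r - (d-s). This uniform range is what lets the sum over s be
    reindexed. *)
Lemma dual_polar_P_conv (R : realType) (d q : nat) (eps : R) (r s : nat) :
  (1 < q)%N -> (s <= d)%N -> (r <= d)%N ->
  dual_polar_P d q eps r (d - s)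
  = \sum_(0 <= t < s.+1)
      ((-1) ^+ (r - t) * gauss_binom R q r t * q%:R ^+ 'C(r - t, 2))
      * (gauss_binom R q (d - r) (s - t)
         * q%:R `^ ('C(d - r - (s - t), 2)%:R + (d - r - (s - t))%:R * eps)).
Proof.
move=> q1 sd rd; rewrite /dual_polar_P subKn //.
rewrite [RHS](big_cat_nat (n := minn s r + 1)%N) //=; try by lia.
rewrite [X in _ = _ + X]big1_seq ?addr0; last first.
  move=> t /=; rewrite mem_index_iota => ht.
  by rewrite (gauss_binom_small R q r t) ?mulr0 ?mul0r //; lia.
rewrite [RHS](big_cat_nat (n := r - (d - s))) //=; try by lia.
rewrite [X in _ = X + _]big1_seq ?add0r; last first.
  move=> t /=; rewrite mem_index_iota => ht.
  by rewrite (gauss_binom_small R q (d - r)) ?mul0r ?mulr0 //; lia.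
rewrite addn1; apply: eq_big_nat => t ht.
rewrite (_ : d - s + t - r = d - r - (s - t))%N; last by lia.
by rewrite -addrA [in LHS]natr_powRD_nat //; ring.
Qed.

Theorem theorem7p4 (R : realType) (X : polar_family) (d q : nat)
    (hd : (1 <= d)%N) (hq : polar_order X q) :
  let eps := polar_type R X in
  (forall a : nat, (a < d)%N ->
     lambda d q eps 0 a
     = \sum_(0 <= s < a.+1)
         gauss_binom R q d s
         * q%:R `^ ('C(d - s, 2)%:R + (d - s)%:R * eps))
  /\
  (forall a r : nat, (a < d)%N -> (0 < r)%N -> (r <= d)%N ->
     lambda d q eps r a
     = (-1) ^+ (r + a)
       * \sum_(a.+1 - r <= s < (minn a (d - r)).+1)
           (-1) ^+ s * Acoef d q eps r s a).
Proof.
move=> eps; have q1 := polar_order_gt1 X q hq; split.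
  (* For r = 0 only t = 0 occurs, so the two sums agree term by term. *)
  move=> a ad; apply: eq_big_nat => s sa.
  rewrite /dual_polar_P minn0 sub0n big_nat1 expr0 mul1r gauss_binom0 mulr1.
  by rewrite !subn0 addn0 subKn ?add0r //; lia.
(* From here r = n+1, so the n left by the telescoped sum is r - 1. *)
move=> a [//|n] ad _ nd; rewrite /lambda.
under eq_big_nat => s sa.
  have sd : (s <= d)%N by lia.
  rewrite dual_polar_P_conv //.
  over.
rewrite (sum_antidiagonals _ (fun t u =>
  ((-1) ^+ (n.+1 - t) * gauss_binom R q n.+1 t * q%:R ^+ 'C(n.+1 - t, 2))
  * (gauss_binom R q (d - n.+1) u
     * q%:R `^ ('C(d - n.+1 - u, 2)%:R + (d - n.+1 - u)%:R * eps)))).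
under eq_bigr => u _ do rewrite -mulr_suml sum_gauss_binom_signed //.
rewrite mulr_sumr.
(* Cutting the sum over u at both bounds requires them to be in order. *)
case: (leqP (a.+1 - n.+1) (minn a (d - n.+1)).+1) => hr; last first.
  rewrite [RHS]big_geq ?(ltnW hr) // big1_seq // => u /=.
  rewrite mem_index_iota => hu; case: (ltnP (d - n.+1) u) => hu'.
    by rewrite (gauss_binom_small R q (d - n.+1)) ?mul0r ?mulr0.
  by rewrite (gauss_binom_small R q n) ?mul0r ?mulr0 ?mul0r //; lia.
(* Above the upper bound [d-r, u] vanishes; below the lower bound a - u > r - 1, so [r-1, a-u]
   vanishes. *)
rewrite (big_cat_nat (n := (minn a (d - n.+1)).+1)) //=; last by lia.
rewrite [X in _ + X = _]big1_seq ?addr0; last first.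
  move=> u /=; rewrite mem_index_iota => hu.
  by rewrite (gauss_binom_small R q (d - n.+1)) ?mul0r ?mulr0 //; lia.
rewrite (big_cat_nat (n := a.+1 - n.+1)) //=.
rewrite [X in X + _ = _]big1_seq ?add0r; last first.
  move=> u /=; rewrite mem_index_iota => hu.
  by rewrite (gauss_binom_small R q n) ?mul0r ?mulr0 ?mul0r //; lia.
apply: eq_big_nat => u hu; rewrite /Acoef powR_mulrn ?ler0n //.
rewrite (_ : n.+1 + u - a = n.+1 - (a - u))%N; last by lia.
(* In this range r - (a - u) is exact, and adding u to it gives the parity of r + a; the two factors
   (-1)^u then square to 1. *)
rewrite (_ : (-1) ^+ (n.+1 + a) = (-1) ^+ (n.+1 - (a - u)) * (-1) ^+ u :> R).
  rewrite subSS subn0 !mulrA; have := sqrr_sign R u.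
  rewrite -!mulrA; move: ((-1) ^+ u) => x hx.
  by rewrite [x * (x * _)]mulrA -expr2 hx mul1r; ring.
rewrite -exprD -[LHS]signr_odd -[RHS]signr_odd; congr (_ ^+ nat_of_bool _).
by lia.
Qed.
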